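(* Let $\Gamma$ be a finite, simple, connected, regular graph on $n$ vertices with diameter $D$ and distinct adjacency eigenvalues $\lambda_0>\lambda_1>\cdots>\lambda_d$ with multiplicities $m_0,\dots,m_d$. Let $0\le h\le D$. Then $$\overline{\delta}_h\le\frac 1n\left(\sum_{i=0}^d\frac{\overline{m}_{hi}^2}{m_i}\right)^{-1},$$ with equality if and only if $\Gamma$ is $h$-punctually distance-polynomial. Moreover, if $A_h=q_h(A)$ for a polynomial $q_h\in\mathbb{R}_d[x]$, then the distance-$h$ graph $\Gamma_h$ is regular, of degree $\delta_h=q_h(\lambda_0)$, and $$\overline{m}_{hi}=\frac{q_h(\lambda_i)}{q_h(\lambda_0)}\frac{m_i}{n}\qquad (i=0,1,\dots,d).$$
   Context: $A$ is the adjacency matrix of $\Gamma$; $\partial(u,v)$ is the distance between vertices $u,v$. The distance-$h$ graph $\Gamma_h$ has the same vertex set, with $u,v$ adjacent iff $\partial(u,v)=h$ in $\Gamma$; its adjacency matrix is the distance-$h$ matrix $A_h$, i.e. $(A_h)_{uv}=1$ if $\partial(u,v)=h$ and $0$ otherwise (so $A_0=I$). $\overline{\delta}_h=\frac1n\sum_{u,v}(A_h)_{uv}$ is the average degree of $\Gamma_h$; $\delta_h$ denotes the degree of $\Gamma_h$ when it is regular. $E_i$ denotes the matrix of the orthogonal projection of $\mathbb{R}^n$ onto the eigenspace $\ker(A-\lambda_i I)$, $m_{uv}(\lambda_i)=(E_i)_{uv}$ are the crossed local multiplicities, and $$\overline{m}_{hi}=\frac1{n\overline{\delta}_h}\sum_{(u,v):\,\partial(u,v)=h}m_{uv}(\lambda_i)$$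 (sum over ordered pairs) are the average crossed local multiplicities. $\mathbb{R}_d[x]$ is the space of real polynomials of degree at most $d$. $\Gamma$ is $h$-punctually distance-polynomial if $A_h=q_h(A)$ for some $q_h\in\mathbb{R}_d[x]$ (equivalently, $A_h$ is a real polynomial in $A$). *)

(* Defs.v *)
From HB Require Import structures.
From mathcomp Require Import all_boot all_order all_algebra.

Set Implicit Arguments.
Unset Strict Implicit.
Unset Printing Implicit Defensive.

Import Order.TTheory GRing.Theory Num.Theory.
Local Open Scope ring_scope.

Section Graphs.
Variables (T : finType) (e : rel T).

Definition simple_graph : Prop := symmetric e /\ irreflexive e.

Definition connected_graph : Prop := forall u v : T, connect e u v.

Definition regular_of_degree (k : nat) : Prop :=
  forall u : T, #|[set v | e u v]| = k.

Definition walk (k : nat) (u v : T) : bool :=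
  [exists p : k.-tuple T, path e u p && (last u p == v)].

(* The least length of a walk from u to v.  A shortest walk has fewer than
   #|T| edges, so the search below is exhaustive; #|T| is returned when v is
   not reachable from u. *)
Definition gdist (u v : T) : nat :=
  find (fun k => walk k u v) (iota 0 #|T|).

Definition diameter : nat := \max_(u : T) \max_(v : T) gdist u v.

(* For h = 0 this is equality, i.e. one loop at each vertex, so that the
   adjacency matrix of the distance-0 graph is the identity. *)
Definition distance_graph (h : nat) : rel T := fun u v => gdist u v == h.

End Graphs.

Section Matrices.
Variables (R : rcfType) (n : nat).

Definition adjmx (e : rel 'I_n) : 'M[R]_n := \matrix_(u, v) (e u v)%:R.

Definition distmx (e : rel 'I_n) (h : nat) : 'M[R]_n :=
  adjmx (distance_graph e h).

Definition avg_degree (e : rel 'I_n) (h : nat) : R :=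
  n%:R^-1 * \sum_u \sum_v distmx e h u v.

(* lambda 0 > ... > lambda d are exactly the distinct eigenvalues of M. *)
Definition distinct_eigenvalues (M : 'M[R]_n) (d : nat)
    (lambda : 'I_d.+1 -> R) : Prop :=
  (forall i j : 'I_d.+1, (i < j)%N -> lambda j < lambda i) /\
  (forall x : R, eigenvalue M x <-> exists i, x = lambda i).

Definition multiplicity (M : 'M[R]_n) (x : R) : nat := \rank (eigenspace M x).

(* Subspaces are row spaces and matrices act on row vectors from the right;
   kermx U^T is the orthogonal complement of (the row space of) U for the
   standard inner product.  The matrix of an orthogonal projection is
   symmetric, so it is the same for column vectors. *)
Definition orthogonal_projection (m : nat) (U : 'M[R]_(m, n)) : 'M[R]_n :=
  proj_mx <<U>>%MS (kermx U^T).

Definition eigenprojection (M : 'M[R]_n) (x : R) : 'M[R]_n :=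
  orthogonal_projection (eigenspace M x).

Definition crossed_mult (e : rel 'I_n) (x : R) (u v : 'I_n) : R :=
  eigenprojection (adjmx e) x u v.

Definition avg_crossed_mult (e : rel 'I_n) (h : nat) (x : R) : R :=
  (n%:R * avg_degree e h)^-1 *
    \sum_(u < n) \sum_(v < n | gdist e u v == h) crossed_mult e x u v.

End Matrices.

(* horner_mx requires a matrix of positive size.  The bound size q <= d + 1
   says that q has degree at most d. *)
Definition punctually_distance_polynomial (R : rcfType) (n : nat)
    (e : rel 'I_n.+1) (d h : nat) : Prop :=
  exists2 q : {poly R}, (size q <= d.+1)%N
    & distmx R e h = horner_mx (adjmx R e) q.

(* Main.v *)
Require Import Defs.
From mathcomp Require Import all_boot all_order all_algebra.
From mathcomp Require Import spectral complex ring.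

(** The eigenprojections E_i are symmetric, sum to the identity and are
    orthogonal for the inner product <B, C> = tr (B C^T), with <E_i, E_i> = m_i;
    moreover <A_h, E_i> = n delta_h mbar_hi and <A_h, A_h> = n delta_h, where
    delta_h is the average degree and mbar_hi the average crossed multiplicity.
    Bessel's inequality for A_h is therefore the bound; equality means that A_h
    lies in the span of the E_i, which by Lagrange interpolation is the space of
    polynomials in A of degree at most d.  Inverting the sum in the bound
    requires it to be nonzero, which holds because E_0 = J / n and some pair of
    vertices is at distance h.  If A_h = q_h(A), then applying both sides to the
    all-ones vector gives regularity, and <A_h, E_i> = q_h(lambda_i) m_i. *)
Set Implicit Arguments.
Unset Strict Implicit.
Unset Printing Implicit Defensive.

Import Order.TTheory GRing.Theory Num.Theory.
Local Open Scope ring_scope.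

(** * Trace of idempotents and diagonalization of symmetric matrices *)

(** In a full-rank factorization P = C B, idempotence reads C B C B = C B. Cancelling C and B gives
    B C = 1, of size the rank, and tr (C B) = tr (B C). *)
Lemma mxtrace_idempotent (F : fieldType) (n : nat) (P : 'M[F]_n) :
  P *m P = P -> \tr P = (\rank P)%:R.
Proof.
move=> PP; move: (mulmx_base P) (row_base_free P) (col_base_full P).
move: (row_base P) (col_base P) => B C CB Bfree Cfull.
suff BC : B *m C = 1%:M by rewrite -{1}CB mxtrace_mulC BC mxtrace1.
apply: (row_free_inj Bfree); apply: (row_full_inj Cfull).
by rewrite mul1mx !mulmxA CB -mulmxA CB.
Qed.

(* Over R[i], A is unitarily diagonalizable with real spectrum, so its minimal
   polynomial, which does not depend on the field, is split with simple roots
   already over R. *)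
Lemma symmetric_diagonalizable (R : rcfType) (n : nat) (A : 'M[R]_n.+1) :
  A^T = A -> diagonalizable A.
Proof.
move=> Asym; pose AC := map_mx (real_complex R) A.
have AC_herm : AC \is hermsymmx.
  apply: realsym_hermsym; last first.
    by apply/mxOverP => i j; rewrite mxE complex_real.
  by apply/is_hermitianmxP; rewrite expr0 scale1r map_mx_id// /AC map_trmx Asym.
have /mxOverP D_real := hermitian_spectral_diag_real AC_herm.
pose D := spectral_diag AC.
have minAC : mxminpoly AC =
    \prod_(r <- undup [seq D 0 i | i <- enum 'I_n.+1]) ('X - r%:P).
  have /orthomx_spectralP -> := hermitian_normalmx AC_herm.
  rewrite -conjVmx ?spectral_unit// mxminpoly_uconj ?unitmx_inv ?spectral_unit//.
  exact: mxminpoly_diag.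
pose s := [seq complex.Re (D 0 i) | i <- enum 'I_n.+1].
apply/diagonalizableP; exists (undup s); first exact: undup_uniq.
rewrite -(dvdp_map (real_complex R)) -mxminpoly_map minAC rmorph_prod /=.
have -> : [seq D 0 i | i <- enum 'I_n.+1] = [seq (real_complex R) x | x <- s].
  rewrite /s -[RHS]map_comp; apply: eq_map => i /=.
  exact/esym/RRe_real.
rewrite (undup_map_inj (@complexI R)) big_map.
by under [X in _ %| X]eq_bigr do rewrite map_polyXsubC.
Qed.

(** * The Frobenius inner product *)

Section Frobenius.
Variable (R : realFieldType).

Lemma mxtrace_mul_tr m n (B C : 'M[R]_(m, n)) :
  \tr (B *m C^T) = \sum_i \sum_j B i j * C i j.
Proof.
by apply: eq_bigr => i _; rewrite mxE; apply: eq_bigr => j _; rewrite mxE.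
Qed.

Lemma frobenius_ge0 m n (B : 'M[R]_(m, n)) : 0 <= \tr (B *m B^T).
Proof.
rewrite mxtrace_mul_tr; apply: sumr_ge0 => i _; apply: sumr_ge0 => j _.
by rewrite -expr2 sqr_ge0.
Qed.

Lemma frobenius_eq0 m n (B : 'M[R]_(m, n)) : \tr (B *m B^T) = 0 -> B = 0.
Proof.
have sq i j : 0 <= B i j * B i j by rewrite -expr2 sqr_ge0.
rewrite mxtrace_mul_tr => /psumr_eq0P B0; apply/matrixP => i j.
have /psumr_eq0P Bi : \sum_j B i j * B i j = 0.
  by apply: B0 => // i' _; apply: sumr_ge0.
by have /eqP := Bi (fun _ _ => sq _ _) j isT; rewrite mulf_eq0 orbb mxE => /eqP.
Qed.

Lemma frobeniusC m n (B C : 'M[R]_(m, n)) : \tr (B *m C^T) = \tr (C *m B^T).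
Proof. by rewrite -mxtrace_tr trmx_mul trmxK. Qed.

(** The rows of W lie in U and are orthogonal to U, so W W^T = 0, and the Frobenius form is
    definite. *)
Lemma cap_genmx_kermx_tr m n (U : 'M[R]_(m, n)) : (<<U>> :&: kermx U^T = 0)%MS.
Proof.
set W := (_ :&: _)%MS; apply: frobenius_eq0.
have /submxP[X WU] : (W <= U)%MS by rewrite (submx_trans (capmxSl _ _)) ?genmxE.
have /sub_kermxP W0 : (W <= kermx U^T)%MS by rewrite capmxSr.
by rewrite {2}WU trmx_mul mulmxA W0 mul0mx mxtrace0.
Qed.

End Frobenius.

(** * Orthogonal projections *)

Section OrthogonalProjection.
Variables (R : rcfType) (m n : nat) (U : 'M[R]_(m, n)).
Let P := orthogonal_projection U.

Lemma orthogonal_projection_sub : (P <= U)%MS.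
Proof. by rewrite -[P]mul1mx (submx_trans (proj_mx_sub _ _ _)) ?genmxE. Qed.

Lemma orthogonal_projection_id p (W : 'M_(p, n)) : (W <= U)%MS -> W *m P = W.
Proof. by move=> WU; rewrite proj_mx_id ?cap_genmx_kermx_tr ?genmxE. Qed.

Lemma orthogonal_projection_idem : P *m P = P.
Proof. exact/orthogonal_projection_id/orthogonal_projection_sub. Qed.

(** The rows of 1 - P are orthogonal to U and those of P lie in U, so (1 - P) P^T = 0. Hence P^T = P
    P^T, which is symmetric. *)
Lemma orthogonal_projection_sym : P^T = P.
Proof.
(* U and its orthogonal complement meet trivially and their dimensions add up to n. *)
have full : (1%:M <= <<U>> + kermx U^T)%MS.
  rewrite sub1mx /row_full mxrank_disjoint_sum ?cap_genmx_kermx_tr//.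
  by rewrite mxrank_gen mxrank_ker mxrank_tr subnKC ?rank_leq_col.
have /sub_kermxP PU : (1%:M - P <= kermx U^T)%MS.
  by have := proj_mx_compl_sub full; rewrite mul1mx.
have /submxP[X PX] := orthogonal_projection_sub.
have : (1%:M - P) *m P^T = 0 by rewrite {2}PX trmx_mul mulmxA PU mul0mx.
rewrite mulmxBl mul1mx => /subr0_eq PPT.
by rewrite PPT -{1}[P]trmxK -trmx_mul -PPT trmxK.
Qed.

Lemma mxtrace_orthogonal_projection : \tr P = (\rank U)%:R.
Proof.
rewrite mxtrace_idempotent ?orthogonal_projection_idem//.
congr _%:R; apply/eqP; rewrite eqn_leq mxrankS ?orthogonal_projection_sub//=.
by rewrite -{1}(@orthogonal_projection_id _ U)// mxrankM_maxr.
Qed.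

End OrthogonalProjection.

(** * Lagrange interpolation and Bessel's inequality *)

Lemma poly_interpolation (F : fieldType) (d : nat) (x c : 'I_d.+1 -> F) :
  injective x ->
  exists2 q : {poly F}, (size q <= d.+1)%N & forall i, q.[x i] = c i.
Proof.
move=> x_inj; pose p i : {poly F} := \prod_(j in predC1 i) ('X - (x j)%:P).
have p_neq0 i : (p i).[x i] != 0.
  rewrite horner_prod; apply/prodf_neq0 => j ji.
  by rewrite hornerXsubC subr_eq0 (inj_eq x_inj) eq_sym.
have p_eq0 i j : j != i -> (p i).[x j] = 0.
  by move=> ji; rewrite horner_prod (bigD1 j)//= hornerXsubC subrr mul0r.
exists (\sum_i (c i / (p i).[x i]) *: p i).
  apply: (leq_trans (size_sum _ _ _)); apply/bigmax_leqP => i _.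
  rewrite (leq_trans (size_scale_leq _ _))// /p -big_enum size_prod_XsubC.
  by rewrite -cardE cardC1 card_ord.
move=> i; rewrite horner_sum (bigD1 i)//= big1 => [|j ji].
  by rewrite hornerZ divfK ?addr0.
by rewrite hornerZ (p_eq0 j i) ?mulr0// eq_sym.
Qed.

(** Pythagoras for the orthogonal projection P of B onto the span of the orthogonal family [E]: both
    <B, P> and <P, P> equal the sum on the right, so the squared norm of the residual B - P is the
    stated difference. *)
Lemma bessel (R : realFieldType) (m n : nat) (I : finType) (E : I -> 'M[R]_(m, n))
    (w : I -> R) (B : 'M[R]_(m, n)) :
  (forall i, w i != 0) ->
  (forall i j, \tr (E i *m (E j)^T) = if i == j then w i else 0) ->
  let D := B - \sum_i (\tr (B *m (E i)^T) / w i) *: E i in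
  \tr (D *m D^T) = \tr (B *m B^T) - \sum_i \tr (B *m (E i)^T) ^+ 2 / w i.
Proof.
move=> w0 orthoE /=; set P := \sum_i _; set S := \sum_i _.
have trBP : \tr (B *m P^T) = S.
  rewrite /P raddf_sum mulmx_sumr raddf_sum; apply: eq_bigr => i _ /=.
  by rewrite linearZ /= -scalemxAr mxtraceZ mulrAC expr2.
have trPP : \tr (P *m P^T) = S.
  rewrite {1}/P mulmx_suml raddf_sum; apply: eq_bigr => i _ /=.
  rewrite -scalemxAl mxtraceZ /P raddf_sum mulmx_sumr raddf_sum /=.
  rewrite (bigD1 i)//= big1 => [|j /negPf ji].
    by rewrite linearZ /= -scalemxAr mxtraceZ orthoE eqxx divfK// addr0 mulrAC expr2.
  by rewrite linearZ /= -scalemxAr mxtraceZ orthoE eq_sym ji mulr0.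
have -> : (B - P)^T = B^T - P^T by rewrite linearB.
rewrite mulmxBl !mulmxBr !(raddfB (@mxtrace _ _)) /= trPP trBP (frobeniusC P) trBP.
ring.
Qed.

(** * Spectral decomposition of a symmetric matrix *)

Section SpectralDecomposition.
Variables (R : rcfType) (n : nat) (A : 'M[R]_n.+1).
Hypothesis Asym : A^T = A.
Local Notation E := (eigenprojection A).

Lemma eigenprojection_sym x : (E x)^T = E x.
Proof. exact: orthogonal_projection_sym. Qed.

Lemma eigenprojection_mulmx x : E x *m A = x *: E x.
Proof. exact/eigenspaceP/orthogonal_projection_sub. Qed.

Lemma mulmx_eigenprojection x : A *m E x = x *: E x.
Proof.
rewrite -{1}Asym -{1}eigenprojection_sym -trmx_mul eigenprojection_mulmx.
by rewrite linearZ /= eigenprojection_sym.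
Qed.

Lemma eigenprojection_idem x : E x *m E x = E x.
Proof. exact: orthogonal_projection_idem. Qed.

(** Letting A act on either factor of E_x A E_y gives x E_x E_y = y E_x E_y. *)
Lemma eigenprojection_ortho x y : x != y -> E x *m E y = 0.
Proof.
move=> xy; have /eqP : (x - y) *: (E x *m E y) = 0.
  rewrite scalerBl scalemxAl -eigenprojection_mulmx -mulmxA mulmx_eigenprojection.
  by rewrite -scalemxAr subrr.
by rewrite scaler_eq0 subr_eq0 (negPf xy) => /eqP.
Qed.

Lemma horner_mx_eigenprojection q x : horner_mx A q *m E x = q.[x] *: E x.
Proof.
elim/poly_ind: q => [|q c IH]; first by rewrite rmorph0 mul0mx horner0 scale0r.
rewrite rmorphD rmorphM /= horner_mx_X horner_mx_C mulmxDl -[_ * A]/(_ *m A).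
rewrite -mulmxA mulmx_eigenprojection -scalemxAr IH scalerA mul_scalar_mx.
by rewrite -scalerDl hornerMXaddC mulrC.
Qed.

Variables (d : nat) (lambda : 'I_d.+1 -> R).
Hypothesis lambda_A : distinct_eigenvalues A lambda.

Lemma distinct_eigenvalues_inj : injective lambda.
Proof.
case: lambda_A => lt_lambda _ i j eq_ij; apply: val_inj.
by case: (ltngtP i j) => // /lt_lambda; rewrite eq_ij ltxx.
Qed.

(** By diagonalizability the eigenspaces span the whole space. On the j-th one only E_j acts
    nontrivially, and it acts as the identity. *)
Lemma sum_eigenprojection : \sum_i E (lambda i) = 1%:M.
Proof.
have /diagonalizablePeigen[rs _ rs1] := symmetric_diagonalizable Asym.
have [_ eigP] := lambda_A.
have full : (1%:M <= \sum_i eigenspace A (lambda i))%MS.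
  rewrite -rs1; apply: (big_ind (fun V : 'M_n.+1 => V <= _)%MS).
  - exact: sub0mx.
  - by move=> V W VS WS; rewrite addsmx_sub VS.
  (* An entry of [rs] that is not an eigenvalue contributes only the zero space. *)
  move=> r _; have [->|r_eig] := eqVneq (eigenspace A r) 0; first exact: sub0mx.
  have [i ->] := iffLR (eigP r) r_eig.
  exact: (sumsmx_sup i).
have: (1%:M <= kermx (\sum_i E (lambda i) - 1%:M))%MS.
  apply: (submx_trans full); apply/sumsmx_subP => j _; apply/sub_kermxP.
  set W := eigenspace _ _.
  have WE : W *m E (lambda j) = W by exact: orthogonal_projection_id.
  rewrite mulmxBr mulmx1 mulmx_sumr (bigD1 j)//= WE big1 ?addr0 ?subrr// => i ij.
  rewrite -WE -mulmxA eigenprojection_ortho ?mulmx0//.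
  by rewrite (inj_eq distinct_eigenvalues_inj) eq_sym.
by move/sub_kermxP; rewrite mul1mx => /subr0_eq.
Qed.

Lemma horner_mx_spectral q :
  horner_mx A q = \sum_i q.[lambda i] *: E (lambda i).
Proof.
rewrite -[LHS]mulmx1 -sum_eigenprojection mulmx_sumr.
by apply: eq_bigr => i _; exact: horner_mx_eigenprojection.
Qed.

(** Interpolating the coefficients at the d + 1 distinct eigenvalues yields the degree bound
    required in the equality case. *)
Lemma sum_eigenprojection_poly (c : 'I_d.+1 -> R) :
  exists2 q : {poly R}, (size q <= d.+1)%N &
    \sum_i c i *: E (lambda i) = horner_mx A q.
Proof.
have [q q_size qc] := poly_interpolation c distinct_eigenvalues_inj.
exists q => //; rewrite horner_mx_spectral.
by apply: eq_bigr => i _; rewrite qc.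
Qed.

Lemma mxtrace_eigenprojection x : \tr (E x) = (multiplicity A x)%:R.
Proof. exact: mxtrace_orthogonal_projection. Qed.

Lemma multiplicity_gt0 i : 0 < (multiplicity A (lambda i))%:R :> R.
Proof.
rewrite ltr0n lt0n mxrank_eq0; case: lambda_A => _ eigP.
by apply: (iffRL (eigP _)); exists i.
Qed.

Lemma frobenius_eigenprojection i j :
  \tr (E (lambda i) *m (E (lambda j))^T) =
    if i == j then (multiplicity A (lambda i))%:R else 0.
Proof.
rewrite eigenprojection_sym; case: eqVneq => [->|ij].
  by rewrite eigenprojection_idem mxtrace_eigenprojection.
by rewrite eigenprojection_ortho ?mxtrace0// (inj_eq distinct_eigenvalues_inj).
Qed.

End SpectralDecomposition.

(** * The largest eigenvalue of a connected regular graph *)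

Section RegularGraph.
Variables (R : rcfType) (n : nat) (e : rel 'I_n.+1) (k : nat).
Hypotheses (simple_e : simple_graph e) (connected_e : connected_graph e).
Hypothesis regular_e : regular_of_degree e k.
Local Notation A := (adjmx R e).

Lemma adjmx_sym : A^T = A.
Proof. by case: simple_e => e_sym _; apply/matrixP => u v; rewrite !mxE e_sym. Qed.

Lemma sum_adjmx_row (u : 'I_n.+1) : \sum_v A u v = k%:R.
Proof.
under eq_bigr do rewrite mxE.
rewrite -(regular_e u) -natr_sum -big_mkcond /= sum1_card.
by congr _%:R; apply: eq_card => v; rewrite !inE.
Qed.

(* Nonnegativity of the left-hand side bounds the eigenvalues by k and, for
   x = k, its vanishing makes v constant along edges. *)
Lemma dirichlet_form (x : R) (v : 'rV[R]_n.+1) : v *m A = x *: v ->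
  \sum_u \sum_w A u w * (v 0 u - v 0 w) ^+ 2 =
    2 * (k%:R - x) * \sum_u v 0 u ^+ 2.
Proof.
move=> vA.
have sq : \sum_u \sum_w A u w * v 0 u ^+ 2 = k%:R * \sum_u v 0 u ^+ 2.
  by rewrite mulr_sumr; apply: eq_bigr => u _; rewrite -mulr_suml sum_adjmx_row.
have sq' : \sum_u \sum_w A u w * v 0 w ^+ 2 = k%:R * \sum_u v 0 u ^+ 2.
  rewrite exchange_big -sq; apply: eq_bigr => u _; apply: eq_bigr => w _.
  by rewrite -{1}adjmx_sym mxE.
have cross : \sum_u \sum_w A u w * (v 0 u * v 0 w) = x * \sum_u v 0 u ^+ 2.
  rewrite exchange_big mulr_sumr; apply: eq_bigr => w _ /=.
  have /matrixP/(_ 0 w) := vA; rewrite !mxE => vAw.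
  rewrite expr2 mulrA -vAw mulr_suml; apply: eq_bigr => u _; ring.
transitivity (\sum_u \sum_w A u w * v 0 u ^+ 2 + \sum_u \sum_w A u w * v 0 w ^+ 2
   - 2 * \sum_u \sum_w A u w * (v 0 u * v 0 w)); last first.
  rewrite sq sq' cross; ring.
rewrite mulr_sumr -big_split -sumrB; apply: eq_bigr => u _ /=.
rewrite mulr_sumr -big_split -sumrB; apply: eq_bigr => w _ /=.
ring.
Qed.

Lemma adjmx_ge0 u w : 0 <= A u w.
Proof. by rewrite mxE ler0n. Qed.

Lemma eigenvalue_le_degree x : eigenvalue A x -> x <= k%:R.
Proof.
case/eigenvalueP => v vA v0.
have v2_gt0 : 0 < \sum_u v 0 u ^+ 2.
  rewrite lt_neqAle sumr_ge0 => [|u _]; last exact: sqr_ge0.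
  rewrite andbT eq_sym; apply: contra v0 => /eqP /psumr_eq0P v0.
  apply/eqP/rowP => u; rewrite mxE; apply/eqP; rewrite -sqrf_eq0.
  by rewrite v0// => w _; exact: sqr_ge0.
have : 0 <= \sum_u \sum_w A u w * (v 0 u - v 0 w) ^+ 2.
  apply: sumr_ge0 => u _; apply: sumr_ge0 => w _.
  by rewrite mulr_ge0 ?adjmx_ge0 ?sqr_ge0.
by rewrite (dirichlet_form vA) pmulr_lge0// pmulr_rge0// subr_ge0.
Qed.

(** The Dirichlet form vanishes, so each of its nonnegative terms does; equality along edges then
    propagates along connecting paths. *)
Lemma eigenvector_degree_const (v : 'rV[R]_n.+1) :
  v *m A = k%:R *: v -> forall u w, v 0 u = v 0 w.
Proof.
move=> /dirichlet_form; rewrite subrr mulr0 mul0r => form0.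
have term_ge0 u w : 0 <= A u w * (v 0 u - v 0 w) ^+ 2.
  by rewrite mulr_ge0 ?adjmx_ge0 ?sqr_ge0.
have step u w : e u w -> v 0 u = v 0 w.
  move=> euw; have := form0 => /psumr_eq0P/(_ u isT) formu.
  have /psumr_eq0P : \sum_w A u w * (v 0 u - v 0 w) ^+ 2 = 0.
    by apply: formu => u' _; apply: sumr_ge0.
  move=> /(_ (fun _ _ => term_ge0 _ _) w isT)/eqP.
  by rewrite mxE euw mul1r sqrf_eq0 subr_eq0 => /eqP.
move=> u w; have /connectP[p] := connected_e u w.
elim: p u => [|y p IH] u /= => [_ -> //|/andP[/step -> ep] lastw].
exact: IH.
Qed.

Lemma const_eigenvector (c : R) : (const_mx c : 'rV_n.+1) *m A = k%:R *: const_mx c.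
Proof.
apply/rowP => w; rewrite !mxE; under eq_bigr do rewrite mxE.
rewrite -mulr_sumr mulrC -(sum_adjmx_row w); congr (_ * _).
by apply: eq_bigr => u _; rewrite -{1}adjmx_sym mxE.
Qed.

Lemma eigenvalue_degree : eigenvalue A k%:R.
Proof.
apply/eigenvalueP; exists (const_mx 1); first exact: const_eigenvector.
by apply/eqP => /rowP/(_ 0)/eqP; rewrite !mxE oner_eq0.
Qed.

(** Each row of E is an eigenvector for k, hence constant. By symmetry all entries agree, and since
    E fixes the all-ones vector their common value is the inverse of the number of vertices. *)
Lemma eigenprojection_degree : eigenprojection A k%:R = const_mx n.+1%:R^-1.
Proof.
set E := eigenprojection _ _.
have Erow u v w : E u v = E u w.
  have : row u E *m A = k%:R *: row u E.
    by rewrite -row_mul eigenprojection_mulmx linearZ.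
  by move/eigenvector_degree_const/(_ v w); rewrite !mxE.
have Esym u v : E u v = E v u.
  by have /matrixP/(_ v u) := eigenprojection_sym A k%:R; rewrite mxE.
have : (const_mx 1 : 'rV_n.+1) *m E = const_mx 1.
  by apply: orthogonal_projection_id; apply/eigenspaceP/const_eigenvector.
move=> /rowP onesE; clearbody E; apply/matrixP => u v; rewrite mxE.
have := onesE v; rewrite !mxE.
(* Each [E w v] becomes [E u v], by way of [E v w] and [E v u]. *)
under eq_bigr => w _ do rewrite mxE mul1r Esym (Erow v w u) Esym.
rewrite sumr_const card_ord => E1; apply: (mulfI (x := n.+1%:R)).
  by rewrite pnatr_eq0.
by rewrite mulfV ?pnatr_eq0// mulr_natl.
Qed.

Variables (d : nat) (lambda : 'I_d.+1 -> R).
Hypothesis lambda_e : distinct_eigenvalues A lambda.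

Lemma lambda0_degree : lambda ord0 = k%:R.
Proof.
have [lt_lambda eig] := lambda_e.
have [i ki] := iffLR (eig _) eigenvalue_degree.
apply: le_anti; rewrite eigenvalue_le_degree; last by apply/eig; exists ord0.
rewrite ki; have [->|i0] := eqVneq i ord0; first by rewrite lexx.
by apply/ltW/lt_lambda; rewrite ltnNge leqn0.
Qed.

End RegularGraph.

(** * Walks and distances *)

Section Distance.
Variables (T : finType) (e : rel T).

Lemma gdist_le k u v : walk e k u v -> (k < #|T|)%N -> (gdist e u v <= k)%N.
Proof.
move=> wk kT; rewrite leqNgt; apply/negP => /(before_find 0).
by rewrite nth_iota// add0n wk.
Qed.

Hypothesis connected_e : connected_graph e.

(** A connecting path shortens to one without repeated vertices, which has fewer than #|T| edges, so
    the search defining [gdist] succeeds. *)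
Lemma walk_gdist u v :
  walk e (gdist e u v) u v /\ (gdist e u v < #|T|)%N.
Proof.
have has_walk : has (fun k => walk e k u v) (iota 0 #|T|).
  have /connectP[p0 ep0 ->] := connected_e u v.
  have [p ep Up _] := shortenP ep0.
  apply/hasP; exists (size p).
    rewrite mem_iota add0n leq0n /=.
    by have := max_card (mem (u :: p)); rewrite (card_uniqP Up).
  by apply/existsP; exists (in_tuple p); rewrite ep eqxx.
have dT : (gdist e u v < #|T|)%N by move: has_walk; rewrite has_find size_iota.
by split=> //; have := nth_find 0 has_walk; rewrite nth_iota.
Qed.

(** On a shortest walk between two vertices realizing the diameter, the vertex reached after h steps
    is at distance h from the start. *)
Lemma exists_at_distance h : (0 < #|T|)%N -> (h <= diameter e)%N ->
  exists u v, gdist e u v = h.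
Proof.
move=> T_gt0; rewrite /diameter.
have [u ->] := @bigop.eq_bigmax T (fun u => \max_v gdist e u v) T_gt0.
have [v ->] := @bigop.eq_bigmax T (gdist e u) T_gt0.
have [/existsP[p /andP[ep /eqP lastp]] dT] := walk_gdist u v.
move: p ep lastp; set D := gdist e u v in dT * => p ep lastp hD.
exists u, (last u (take h p)).
have [/andP[e1 e2] last2] : path e u (take h p) && path e (last u (take h p)) (drop h p)
   /\ last (last u (take h p)) (drop h p) = v.
  by rewrite -cat_path -last_cat cat_take_drop.
have sz1 : size (take h p) = h by rewrite size_takel// size_tuple.
set w := last _ _ in e2 last2 *.
have le_h : (gdist e u w <= h)%N.
  apply: gdist_le; last exact: leq_ltn_trans dT.
  apply/existsP; exists (Tuple (introT eqP sz1)); by rewrite e1 eqxx.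
apply/eqP; rewrite eqn_leq le_h /= leqNgt; apply/negP => lt_h.
have [/existsP[p' /andP[ep' /eqP lastp']] _] := walk_gdist u w.
(* Were w closer than h, a shortest walk to w followed by the rest of p would join u to v in fewer
   than D steps. *)
have short : (gdist e u w + (D - h) < D)%N by rewrite -{2}(subnKC hD) ltn_add2r.
have szp : size (p' ++ drop h p) == (gdist e u w + (D - h))%N.
  by rewrite size_cat size_drop !size_tuple.
have : walk e (gdist e u w + (D - h)) u v.
  apply/existsP; exists (Tuple szp).
  by rewrite /= cat_path ep' lastp' e2 last_cat lastp' last2 eqxx.
by move/gdist_le/(_ (ltn_trans short dT)); rewrite -/D leqNgt short.
Qed.

End Distance.

(** * Distance matrices as vectors in the Frobenius space *)

Section DistanceMatrix.
Variables (R : rcfType) (n : nat) (e : rel 'I_n.+1) (h : nat).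
Local Notation Ah := (distmx R e h).

Lemma mxtrace_mul_distmx (B : 'M[R]_n.+1) :
  \tr (B *m Ah^T) = \sum_u \sum_(v < n.+1 | gdist e u v == h) B u v.
Proof.
rewrite mxtrace_mul_tr; apply: eq_bigr => u _; rewrite [RHS]big_mkcond /=.
apply: eq_bigr => v _; rewrite !mxE /distance_graph.
by case: eqP => _; rewrite ?mulr1 ?mulr0.
Qed.

Lemma sum_distmx : \sum_u \sum_v Ah u v = n.+1%:R * avg_degree R e h.
Proof. by rewrite /avg_degree mulVKf// pnatr_eq0. Qed.

(** The entries are 0 or 1, hence equal to their squares. *)
Lemma frobenius_distmx : \tr (Ah *m Ah^T) = n.+1%:R * avg_degree R e h.
Proof.
rewrite -sum_distmx mxtrace_mul_tr.
apply: eq_bigr => u _; apply: eq_bigr => v _; rewrite !mxE.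
by rewrite -natrM mulnb andbb.
Qed.

Lemma sum_distmx_row u :
  \sum_v Ah u v = #|[set v | distance_graph e h u v]|%:R.
Proof.
under eq_bigr do rewrite mxE.
rewrite -natr_sum -big_mkcond /= sum1_card.
by congr _%:R; apply: eq_card => v; rewrite !inE.
Qed.

Lemma avg_crossed_multE x :
  avg_crossed_mult e h x =
    (n.+1%:R * avg_degree R e h)^-1 * \tr (Ah *m (eigenprojection (adjmx R e) x)^T).
Proof. by rewrite frobeniusC mxtrace_mul_distmx. Qed.

Lemma avg_degree_gt0 : connected_graph e -> (h <= diameter e)%N ->
  0 < avg_degree R e h.
Proof.
move=> connected_e hD.
have [|u [v uvh]] := exists_at_distance connected_e _ hD.
  by rewrite card_ord.
rewrite mulr_gt0 ?invr_gt0 ?ltr0n//.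
have Ah_ge0 x y : 0 <= Ah x y by rewrite mxE ler0n.
rewrite (bigD1 u)//= ltr_pwDl//; last first.
  by apply: sumr_ge0 => x _; apply: sumr_ge0.
rewrite (bigD1 v)//= ltr_pwDl//; last exact: sumr_ge0.
by rewrite mxE /distance_graph uvh eqxx ltr01.
Qed.

End DistanceMatrix.

(** * The bound, its equality case, and regularity of the distance graph *)

Unset Implicit Arguments.

Theorem proposition4p1 (R : rcfType) (n : nat) (e : rel 'I_n.+1) (k : nat)
    (d : nat) (lambda : 'I_d.+1 -> R) (h : nat)
    (simple_e : simple_graph e)
    (connected_e : connected_graph e)
    (regular_e : regular_of_degree e k)
    (lambda_e : distinct_eigenvalues (adjmx R e) lambda)
    (le_h_D : (h <= diameter e)%N) :
  let m := fun i : 'I_d.+1 => (multiplicity (adjmx R e) (lambda i))%:R : R in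
  let bound := n.+1%:R^-1 *
    (\sum_(i < d.+1) avg_crossed_mult e h (lambda i) ^+ 2 / m i)^-1 in
  [/\ avg_degree R e h <= bound,
      avg_degree R e h = bound <-> punctually_distance_polynomial R e d h
    & forall q : {poly R}, (size q <= d.+1)%N ->
        distmx R e h = horner_mx (adjmx R e) q ->
        (exists2 delta : nat, regular_of_degree (distance_graph e h) delta
           & delta%:R = q.[lambda ord0]) /\
        (forall i : 'I_d.+1,
           avg_crossed_mult e h (lambda i) =
             q.[lambda i] / q.[lambda ord0] * (m i / n.+1%:R))].
Proof.
move=> m bound.
set A := adjmx R e; set Ah := distmx R e h.
pose E i := eigenprojection A (lambda i).
(* In Frobenius terms, [f i] is <A_h, E_i>, [s] is <A_h, A_h>, and [S] is the squared norm of the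
   projection of A_h onto the span of the E_i. *)
pose f i := \tr (Ah *m (E i)^T).
pose s := n.+1%:R * avg_degree R e h.
pose S := \sum_i f i ^+ 2 / m i.
have mbarE i : avg_crossed_mult e h (lambda i) = s^-1 * f i.
  exact: avg_crossed_multE.
have Asym : A^T = A by exact: adjmx_sym simple_e.
have N_neq0 : n.+1%:R != 0 :> R by rewrite pnatr_eq0.
have s_gt0 : 0 < s by rewrite mulr_gt0 ?ltr0n// avg_degree_gt0.
have m_gt0 i : 0 < m i by exact: multiplicity_gt0.
have m_neq0 i := lt0r_neq0 (m_gt0 i).
have term_ge0 i : 0 <= f i ^+ 2 / m i by rewrite divr_ge0 ?sqr_ge0 ?ltW.
have lambda0 : lambda ord0 = k%:R by exact: (lambda0_degree simple_e regular_e lambda_e).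
have f0 : f ord0 = avg_degree R e h.
  rewrite /f /E lambda0 (eigenprojection_degree R simple_e connected_e regular_e).
  rewrite mxtrace_mul_tr /avg_degree mulr_sumr.
  apply: eq_bigr => u _; rewrite mulr_sumr; apply: eq_bigr => v _.
  by rewrite [const_mx _ _ _]mxE mulrC.
(* The term for [ord0] is already positive. This rules out the default value 0 of the inverse of 0
   in [bound]. *)
have S_gt0 : 0 < S.
  rewrite /S (bigD1 ord0)//= ltr_pwDl ?sumr_ge0// f0.
  by rewrite divr_gt0// exprn_gt0// avg_degree_gt0.
have bessel_Ah : let D := Ah - \sum_i (f i / m i) *: E i in
    \tr (D *m D^T) = s - S.
  rewrite /= bessel//; first by rewrite frobenius_distmx.
  by move=> i j; exact: frobenius_eigenprojection.
(* The sum in [bound] is S / s^2. Comparing the average degree with [bound] thus amounts to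
   comparing S with s. *)
have bound_eq : bound = avg_degree R e h * (s / S).
  rewrite /bound (_ : \sum_i _ = S / s ^+ 2).
    rewrite invf_div expr2 -(mulrA s s) [LHS]mulrA; congr (_ * _).
    by rewrite /s mulKf.
  rewrite /S mulr_suml; apply: eq_bigr => i _.
  by rewrite mbarE exprMn exprVn -[LHS]mulrA [LHS]mulrC.
have delta_gt0 : 0 < avg_degree R e h by exact: avg_degree_gt0.
have delta_neq0 := lt0r_neq0 delta_gt0.
have poly_f q : Ah = horner_mx A q -> forall i, f i = q.[lambda i] * m i.
  move=> Ahq i; rewrite /f Ahq eigenprojection_sym horner_mx_eigenprojection//.
  by rewrite mxtraceZ mxtrace_eigenprojection.
have bound_eqE : avg_degree R e h = bound <-> s = S.
  rewrite bound_eq; split=> [|->]; last by rewrite divff ?mulr1// gt_eqF.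
  rewrite -{1}[avg_degree R e h]mulr1 => /(mulfI delta_neq0)/esym/divr1_eq.
  exact.
split.
- rewrite bound_eq ler_pMr// ler_pdivlMr// mul1r -subr_ge0 -bessel_Ah.
  exact: frobenius_ge0.
- rewrite bound_eqE; split=> [sS|[q _ Ahq]].
    (* The residual has norm zero, so A_h lies in the span of the E_i. *)
    have /= := bessel_Ah; rewrite sS subrr => /frobenius_eq0/subr0_eq AhE.
    have [q q_size qE] := sum_eigenprojection_poly Asym lambda_e (fun i => f i / m i).
    by exists q => //; rewrite -/Ah AhE qE.
  (* Here f_i / m_i = q(lambda_i), so the spectral expansion of q(A) is its own projection and the
     residual vanishes. *)
  have AhE : Ah = \sum_i (f i / m i) *: E i.
    rewrite {1}[Ah]Ahq (horner_mx_spectral Asym lambda_e).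
    by apply: eq_bigr => i _; rewrite (poly_f q)// mulfK.
  have /= := bessel_Ah; rewrite -AhE subrr mul0mx mxtrace0.
  by move/esym/subr0_eq.
move=> q _ Ahq.
(* Diagonal entry (u, u) of q(A) E_0 = q(lambda_0) E_0, where E_0 is constant: the left side is the
   row sum of A_h times that constant, which cancels. *)
have row_q u : \sum_v Ah u v = q.[lambda ord0].
  have /matrixP/(_ u u) := horner_mx_eigenprojection Asym q (lambda ord0).
  rewrite -Ahq lambda0 (eigenprojection_degree R simple_e connected_e regular_e) !mxE.
  under eq_bigr do rewrite [const_mx _ _ _]mxE.
  by rewrite -mulr_suml => /(mulIf _); apply; rewrite invr_eq0.
have avg_q : avg_degree R e h = q.[lambda ord0].
  rewrite /avg_degree; under eq_bigr do rewrite row_q.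
  by rewrite sumr_const card_ord -[X in _ * X]mulr_natl mulKf.
split.
  (* The degree is read off at [ord0]. All row sums agree in [R], and the embedding of the naturals
     is injective. *)
  exists #|[set v | distance_graph e h ord0 v]|; last first.
    by rewrite -(row_q ord0) sum_distmx_row.
  move=> u; apply/eqP; rewrite -(eqr_nat R) -!sum_distmx_row.
  by rewrite !row_q.
(* Since the average degree is q(lambda_0), the normalization s equals n q(lambda_0), with n the
   number of vertices. *)
move=> i; rewrite mbarE (poly_f q)// -avg_q /s.
by rewrite invfM [RHS]mulrACA [RHS]mulrC [X in X * _]mulrC.
Qed.
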